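(* Let $G$ be a finite group and $Z$ a subgroup of the center $Z(G)$. Then for any $\phi\in\mathrm{Irr}(Z)$, $$\mu_\phi(G)=\kappa_{\mathrm{Ker}\,\phi}(G)^2\,\mu_{\overline{\phi}}(G/\mathrm{Ker}\,\phi).$$
   Context: Let $G$ be a finite group. $\mathrm{Irr}$ denotes the set of irreducible complex characters, $\mathrm{Conj}(G)$ the set of conjugacy classes of $G$, and $C_G(g)$ the centralizer of $g$. The group algebra $\mathbb{C}G$ has basis $\{[g]\mid g\in G\}$ with $[g][h]=[gh]$; $[S]=\sum_{g\in S}[g]$ for $S\subset G$; $Z(\mathbb{C}G)$ is its center. Let $\overline{\sum_g c_g[g]}=\sum_g\overline{c_g}[g^{-1}]$, and for $u,v\in Z(\mathbb{C}G)$ let $\langle u|v\rangle=\mathrm{tr}_{Z(\mathbb{C}G)}(\overline{u}v)$, where $\mathrm{tr}_{Z(\mathbb{C}G)}(u)$ is the trace of $w\mapsto uw$ on $Z(\mathbb{C}G)$. For a finite ordered set $\mathcal{B}\subset Z(\mathbb{C}G)$ put $\gamma(\mathcal{B})=|\det(\langle u|v\rangle)_{u,v\in\mathcal{B}}|$. Let $Z\le Z(G)$. $Z$ acts on $\mathrm{Conj}(G)$ by $(z,K)\mapsto zK$. The $Z$-orbits are indexed by the classes of $G/Z$: write $\mathrm{Conj}(G/Z)=\{\overline{K}_i\mid i\in I_{G/Z}\}$, choose $g_i\in G$ whose image in $G/Z$ lies in $\overline{K}_i$, and let $K_i$ be the conjugacy class of $g_i$ in $G$; then $\{K_i\mid i\in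 I_{G/Z}\}$ is a complete set of representatives of the $Z$-orbits in $\mathrm{Conj}(G)$. For $K\in\mathrm{Conj}(G)$ let $\mathrm{Ann}_Z(K)=\{z\in Z\mid zK=K\}$, and for $N\le Z$ let $I(G:Z)_N=\{j\in I_{G/Z}\mid\mathrm{Ann}_Z(K_j)=N\}$. For $\phi\in\mathrm{Irr}(Z)$ put $e_\phi=\frac{1}{|Z|}\sum_{z\in Z}\overline{\phi(z)}[z]$, $\mathcal{B}(G)_\phi=\{e_\phi[K_j]\mid X\le\mathrm{Ker}\,\phi,\ j\in I(G:Z)_X\}$, $\gamma_\phi(G)=\gamma(\mathcal{B}(G)_\phi)$, $c_\phi(G)=\prod_{N\le\mathrm{Ker}\,\phi}\prod_{j\in I(G:Z)_N}|C_G(g_j)|\,|Z/N|^{-1}$, and $\mu_\phi(G)=\gamma_\phi(G)/c_\phi(G)$. (These numbers do not depend on the choices of the $g_i$.) For $N\le Z$ put $\kappa_N(G)=\prod_{X\le N}|X|^{|I(G:Z)_X|}$. For $\phi\in\mathrm{Irr}(Z)$, $\overline{\phi}$ is the faithful irreducible character of $Z/\mathrm{Ker}\,\phi$ given by $\overline{\phi}(z\,\mathrm{Ker}\,\phi)=\phi(z)$, and $\mu_{\overline{\phi}}(G/\mathrm{Ker}\,\phi)$ is defined by the same construction applied to the group $G/\mathrm{Ker}\,\phi$ and its central subgroup $Z/\mathrm{Ker}\,\phi$. *)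

(* Defs.v *)
From HB Require Import structures.
From mathcomp Require Import all_boot all_order all_algebra all_fingroup.
From mathcomp Require Import all_solvable all_field all_character.

Set Implicit Arguments.
Unset Strict Implicit.
Unset Printing Implicit Defensive.

Import Order.TTheory GRing.Theory Num.Theory.
Local Open Scope ring_scope.

(* As everywhere in the MathComp character library, the field of complex
   numbers is algC.  An element u of the group algebra is the function
   g |-> u g giving its coefficients. *)
Definition galg (gT : finGroupType) : Type := {ffun gT -> algC^o}.

Section GroupAlgebra.
Variable gT : finGroupType.

HB.instance Definition _ := Vector.copy (galg gT) {ffun gT -> algC^o}.

Definition gbase (g : gT) : galg gT := [ffun h => (h == g)%:R].

Definition galg_mul (u v : galg gT) : galg gT :=
  [ffun x => \sum_(y : gT) u y * v (y^-1 * x)%g].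

Fact galg_mulA : associative galg_mul.
Proof.
move=> u v w; apply/ffunP=> x; rewrite !ffunE.
under eq_bigr do rewrite ffunE big_distrr /=.
under [RHS]eq_bigr do rewrite ffunE big_distrl /=.
rewrite [RHS]exchange_big /=; apply: eq_bigr => y _.
rewrite [RHS](reindex_inj (mulgI y)) /=; apply: eq_bigr => z _.
by rewrite invMg mulKg !mulgA mulrA.
Qed.

Fact galg_mul1l : left_id (gbase 1) galg_mul.
Proof.
move=> u; apply/ffunP=> x; rewrite ffunE (bigD1 1%g) //= big1 => [|y /negPf yN1].
  by rewrite ffunE eqxx mul1r invg1 mul1g addr0.
by rewrite ffunE yN1 mul0r.
Qed.

Fact galg_mul1r : right_id (gbase 1) galg_mul.
Proof.
move=> u; apply/ffunP=> x; rewrite ffunE (bigD1 x) //= big1 => [|y yNx].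
  by rewrite ffunE mulVg eqxx mulr1 addr0.
by rewrite ffunE -(inj_eq (mulgI y)) mulKVg mulg1 eq_sym (negPf yNx) mulr0.
Qed.

Fact galg_mulDl : left_distributive galg_mul +%R.
Proof.
move=> u v w; apply/ffunP=> x; rewrite !ffunE -big_split /=.
by apply: eq_bigr => y _; rewrite ffunE mulrDl.
Qed.

Fact galg_mulDr : right_distributive galg_mul +%R.
Proof.
move=> u v w; apply/ffunP=> x; rewrite !ffunE -big_split /=.
by apply: eq_bigr => y _; rewrite ffunE mulrDr.
Qed.

Fact galg_1neq0 : gbase 1 != 0.
Proof.
by apply/eqP=> /ffunP/(_ 1%g)/eqP; rewrite !ffunE eqxx oner_eq0.
Qed.

HB.instance Definition _ := GRing.Zmodule_isNzRing.Build (galg gT)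
  galg_mulA galg_mul1l galg_mul1r galg_mulDl galg_mulDr galg_1neq0.

Fact galg_scaleAl (a : algC) (u v : galg gT) : a *: (u * v) = (a *: u) * v.
Proof.
apply/ffunP=> x; rewrite !ffunE scaler_sumr.
by apply: eq_bigr => y _; rewrite ffunE -scalerAl.
Qed.

HB.instance Definition _ :=
  GRing.Lmodule_isLalgebra.Build algC (galg gT) galg_scaleAl.

Fact galg_scaleAr (a : algC) (u v : galg gT) : a *: (u * v) = u * (a *: v).
Proof.
apply/ffunP=> x; rewrite !ffunE scaler_sumr.
by apply: eq_bigr => y _; rewrite ffunE -scalerAr.
Qed.

HB.instance Definition _ :=
  GRing.Lalgebra_isAlgebra.Build algC (galg gT) galg_scaleAr.

HB.instance Definition _ := Algebra_isFalgebra.Build algC (galg gT).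

Lemma gbaseM (g h : gT) : gbase g * gbase h = gbase (g * h).
Proof.
apply/ffunP=> x; rewrite !ffunE (bigD1 g) //= big1 => [|y /negPf yNg].
  by rewrite !ffunE eqxx mul1r addr0 -(inj_eq (mulgI g)) mulKVg.
by rewrite ffunE yNg mul0r.
Qed.

Lemma galg_sum_gbase (u : galg gT) : u = \sum_g u g *: gbase g.
Proof.
apply/ffunP=> x; rewrite sum_ffunE (bigD1 x) //= big1 => [|y /negPf yNx].
  by rewrite !ffunE eqxx [_ *: _]mulr1 addr0.
by rewrite !ffunE eq_sym yNx scaler0.
Qed.

Definition gsum (S : {set gT}) : galg gT := \sum_(g in S) gbase g.

Definition galg_conj (u : galg gT) : galg gT :=
  \sum_(g : gT) (u g)^* *: gbase g^-1%g.

(* CG, as a subspace of the group algebra of the ambient group gT. *)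
Definition galg_of (G : {set gT}) : {vspace galg gT} :=
  <<[seq gbase g | g <- enum G]>>%VS.

Definition galg_center (G : {set gT}) : {vspace galg gT} := 'Z(galg_of G)%VS.

End GroupAlgebra.

(* The trace of the restriction of f to U, for U stable under f. *)
Definition trace_on (K : fieldType) (vT : vectType K) (U : {vspace vT})
    (f : 'End(vT)) : K :=
  \tr (\matrix_(i < \dim U, j < \dim U)
         coord (vbasis U) j (f (vbasis U)`_i)).

Section Gamma.
Variables (gT : finGroupType) (G : {set gT}).

Definition tr_center (u : galg gT) : algC :=
  trace_on (galg_center G) (amull u).

Definition galg_dot (u v : galg gT) : algC := tr_center (galg_conj u * v).

Definition gamma (B : seq (galg gT)) : algC :=
  `| \det (\matrix_(i < size B, j < size B) galg_dot B`_i B`_j) |.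

End Gamma.

Section Mu.
Variables (gT : finGroupType) (G Z : {group gT}).

(* The index set I_{G/Z} is classes (G / Z) itself; a choice of the elements
   g_i is a function g on it. *)
Definition class_choice (g : {set coset_of Z} -> gT) : Prop :=
  forall i, i \in classes (G / Z)%g -> g i \in G /\ coset Z (g i) \in i.

Variable g : {set coset_of Z} -> gT.

Definition lifted_class (i : {set coset_of Z}) : {set gT} := (g i ^: G)%g.

Definition AnnZ (K : {set gT}) : {set gT} := [set z in Z | z *: K == K]%g.

Definition IZ (N : {set gT}) : {set {set coset_of Z}} :=
  [set j in classes (G / Z)%g | AnnZ (lifted_class j) == N].

Definition e_ (phi : 'CF(Z)) : galg gT :=
  #|Z|%:R^-1 *: \sum_(z in Z) (phi z)^* *: gbase z.

Definition basis_phi (phi : 'CF(Z)) : seq (galg gT) :=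
  [seq e_ phi * gsum (lifted_class j)
     | X : {group gT} <- enum (subgroups (cfker phi)),
       j : {set coset_of Z} <- enum (IZ X)].

Definition gamma_phi (phi : 'CF(Z)) : algC := gamma G (basis_phi phi).

Definition c_phi (phi : 'CF(Z)) : algC :=
  \prod_(N in subgroups (cfker phi)) \prod_(j in IZ N)
     (#|'C_G[g j]%g|%:R * #|(Z / N)%g|%:R^-1).

Definition mu (phi : 'CF(Z)) : algC := gamma_phi phi / c_phi phi.

Definition kappa (N : {set gT}) : nat :=
  (\prod_(X in subgroups N) #|X| ^ #|IZ X|)%N.

End Mu.

(* Main.v *)
Require Import Defs.
From HB Require Import structures.
From mathcomp Require Import all_boot all_order all_algebra all_fingroup.
From mathcomp Require Import all_solvable all_field all_character.

Set Implicit Arguments.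
Unset Strict Implicit.
Unset Printing Implicit Defensive.

Import Order.TTheory GRing.Theory Num.Theory.
Local Open Scope ring_scope.

(** Write N for the kernel of phi, Gb for G / N, xb for the image of x in Gb,
   phib for the character of Z / N induced by phi, K_x for the class of x in G
   and a_x for e_phi [K_x].

   The projection CG -> C[Gb] (push) sends e_phi to e_phib (push_e), and it
   sends [K_x] to |Ann_N(K_x)| [K_xb], since the elements of K_x over xb are the
   n x with n in Ann_N(K_x) (push_gsum_class).  When Ann_Z(K_x) is contained in
   N, it therefore sends a_x to |Ann_Z(K_x)| e_phib [K_xb] (push_e_gsum).

   The projection also preserves the traces that occur in the Gram matrix.  For
   w in Z(CG), the expansion v = sum_x v(x) c_x of central elements in the class
   averages c_x = [K_x] / |K_x| gives tr(w) = sum_(x in G) (w c_x)(x)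
   (tr_centerE).  Averages project to averages (push_cavg), and if w is invariant
   under translation by N, its value at x is |N|^-1 times the value of its image
   at xb.  Hence tr(w) is the trace of the image of w (tr_center_push).  As
   phi is trivial on N, e_phi absorbs N, so this applies to the products
   conj(a_x) a_t.

   The classes j of G / Z with Ann_Z(K_j) contained in N correspond to the
   classes of Gb / (Z / N) whose annihilator in Z / N is trivial
   (perm_quotient_class).  The representative chosen in Gb may differ from the
   image of g_j by conjugation and by an element of Z / N, which only multiplies
   the basis element by a root of unity.  So the Gram matrix of G is
   D^* M D with M that of Gb, up to the order of the basis, and D diagonal with
   entries of modulus |Ann_Z(K_j)| (gamma_transfer); the determinant of D
   contributes the factor kappa_N(G)^2.

   Finally |C_G(x)| |Ann_N(K_x)| = |N| |C_Gb(xb)| (card_cent_quotient) makes the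
   normalising products c_phi(G) and c_phib(Gb) equal factor by factor
   (c_term_quotient). *)

(** * Traces and the group algebra *)

(** The vectors b i need not be independent: composing f with the resolution
   of the identity writes it as a sum of the rank one maps v |-> c i v *: f (b i),
   of trace c i (f (b i)).  This allows sums over the elements of a group where a
   basis would require one representative for each class. *)
Lemma trace_on_frame (K : fieldType) (vT : vectType K) (U : {vspace vT})
    (f : 'End(vT)) (I : finType) (P : pred I) (b : I -> vT) (c : I -> vT -> K) :
    (forall i, scalar (c i)) ->
    {in U, forall v, v = \sum_(i | P i) c i v *: b i} ->
    (forall i, P i -> f (b i) \in U) ->
  trace_on U f = \sum_(i | P i) c i (f (b i)).
Proof.
move=> c_lin cU fbU; pose V := vbasis U.
have VU i : V`_i \in U.
  have [ltiV | leVi] := ltnP i (size V); last by rewrite nth_default ?mem0v.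
  by rewrite vbasis_mem ?mem_nth.
have c_sum i n (a : 'I_n -> K) (v : 'I_n -> vT) :
  c i (\sum_k a k *: v k) = \sum_k a k * c i (v k).
  have c0 : c i 0 = 0.
    by have := c_lin i (-1) 0 0; rewrite scaler0 addr0 mulN1r addNr.
  elim/big_rec2: _ => [|k x y _ IH]; first exact: c0.
  by rewrite c_lin IH.
rewrite /trace_on /mxtrace;
  under eq_bigr => i _ do rewrite mxE [in f _](cU _ (VU i)).
transitivity (\sum_(i < \dim U) \sum_(k | P k) coord V i (f (b k)) * c k V`_i).
  apply: eq_bigr => i _; rewrite linear_sum /= linear_sum /=.
  by apply: eq_bigr => k _; rewrite !linearZ mulrC.
(* c k, applied to the expansion of f (b k) in the basis V, gives the term of k. *)
rewrite exchange_big /=; apply: eq_bigr => k Pk.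
by rewrite -c_sum -coord_vbasis ?fbU.
Qed.

Section GroupAlgebraFacts.
Variables (gT : finGroupType) (G : {group gT}).
Implicit Types (u v w : galg gT) (x y : gT).

(** The coefficients are stated in algC: those of galg live in its regular
   module algC^o, where the ring lemmas do not apply directly. *)
Lemma galg_sumE (I : Type) (r : seq I) (P : pred I) (F : I -> galg gT) x :
  (\sum_(i <- r | P i) F i) x = \sum_(i <- r | P i) F i x :> algC.
Proof. exact: sum_ffunE. Qed.

Lemma galg_scaleE (a : algC) u x : (a *: u) x = a * u x :> algC.
Proof. exact: ffunE. Qed.

Lemma galg_mulE u v x : (u * v) x = \sum_y u y * v (y^-1 * x)%g :> algC.
Proof. exact: ffunE. Qed.

Lemma gbaseE x y : gbase x y = (y == x)%:R :> algC.
Proof. exact: ffunE. Qed.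

Lemma gsumE (S : {set gT}) x : gsum S x = (x \in S)%:R :> algC.
Proof.
rewrite galg_sumE; under eq_bigr => y _ do rewrite gbaseE.
have [Sx | Sx] := boolP (x \in S).
  rewrite (bigD1 x) // eqxx big1 /=; last first.
   by move=> y /andP[_ /negPf]; rewrite eq_sym => ->.
  by rewrite addr0.
by rewrite big1 // => y Sy; case: eqP Sx Sy => // -> /negPf->.
Qed.

Lemma gbase_mull y u x : (gbase y * u) x = u (y^-1 * x)%g :> algC.
Proof.
rewrite galg_mulE (bigD1 y) //= big1 ?addr0 => [|z /negPf zy]; rewrite gbaseE.
  by rewrite eqxx mul1r.
by rewrite zy mul0r.
Qed.

Lemma gbase_mulr y u x : (u * gbase y) x = u (x * y^-1)%g :> algC.
Proof.
rewrite galg_mulE (bigD1 (x * y^-1)%g) //= big1 ?addr0 => [|z zy];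
  rewrite gbaseE.
  by rewrite invMg invgK mulgKV eqxx mulr1.
by rewrite (_ : _ == _ = false) ?mulr0 //; apply: contraNF zy => /eqP<-;
  rewrite invMg mulKVg invgK.
Qed.

Lemma galg_conjE u x : galg_conj u x = (u x^-1%g)^* :> algC.
Proof.
rewrite galg_sumE (bigD1 x^-1%g) //= big1 ?addr0 => [|y yx];
  rewrite galg_scaleE gbaseE.
  by rewrite invgK eqxx mulr1.
by rewrite -(inj_eq invg_inj) invgK eq_sym (negPf yx) mulr0.
Qed.

Lemma galg_ofP u :
  reflect (forall x, x \notin G -> u x = 0) (u \in galg_of G).
Proof.
apply: (iffP idP) => [uG x Gx | uG].
  rewrite (coord_span uG) galg_sumE big1 // => i _.
  have ltiG: (i < size (enum G))%N by rewrite -cardE; apply: ltn_ord.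
  rewrite galg_scaleE (nth_map 1%g) // gbaseE.
  rewrite (_ : _ == _ = false) ?mulr0 //.
  apply: contraNF Gx => /eqP->; rewrite -mem_enum mem_nth // -cardE.
rewrite (galg_sum_gbase u) memv_suml // => x _.
have [Gx | /uG->] := boolP (x \in G); last by rewrite scale0r mem0v.
by rewrite memvZ // memv_span // map_f ?mem_enum.
Qed.

Lemma gbase_galg_of x : x \in G -> gbase x \in galg_of G.
Proof. by move=> Gx; rewrite memv_span // map_f ?mem_enum. Qed.

Lemma galg_of_sum u : u \in galg_of G -> u = \sum_(x in G) u x *: gbase x.
Proof.
move/galg_ofP=> uG; rewrite {1}[u]galg_sum_gbase (bigID [in G]) /=.
by rewrite [X in _ + X]big1 ?addr0 // => x /uG->; rewrite scale0r.
Qed.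

Lemma galg_of_mul u v : u \in galg_of G -> v \in galg_of G ->
  u * v \in galg_of G.
Proof.
move=> uG vG; rewrite (galg_of_sum uG) (galg_of_sum vG) mulr_suml memv_suml //
  => x Gx.
rewrite mulr_sumr memv_suml // => y Gy.
by rewrite -scalerAl -scalerAr gbaseM !memvZ // gbase_galg_of ?groupM.
Qed.

Lemma galg_centerP u :
  reflect [/\ u \in galg_of G
            & forall x y, y \in G -> u (x ^ y)%g = u x] (u \in galg_center G).
Proof.
rewrite memv_cap; apply: (iffP andP) => -[uG uJ]; split=> //.
  move=> x y Gy; have /centvP/(_ _ (gbase_galg_of Gy))/ffunP/(_ (x * y)%g) :=
    uJ.
  by rewrite gbase_mull gbase_mulr mulgK conjgE.
apply/centvP=> v /galg_of_sum->; rewrite mulr_sumr mulr_suml.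
apply: eq_bigr => y Gy; rewrite -scalerAl -scalerAr; congr (_ *: _).
apply/ffunP=> x; rewrite gbase_mull gbase_mulr -(uJ _ y Gy).
by rewrite conjgE mulgKV.
Qed.

End GroupAlgebraFacts.

(** * The centre and its trace *)

Section Centre.
Variables (gT : finGroupType) (G : {group gT}).
Implicit Types (u v w : galg gT) (x y z : gT).

(** For x in H, this is the class sum of x divided by the size of the class.
   Averaging over H instead of summing over the class makes the definition
   compatible with quotients, as the size of the class never appears. *)
Definition cavg (H : {set gT}) x : galg gT :=
  #|H|%:R^-1 *: \sum_(y in H) gbase (x ^ y)%g.

Lemma mem_cent1J x y : (y \in 'C[x]%g) = (x ^ y == x)%g.
Proof.
rewrite cent1C; apply/cent1P/eqP => [cxy | xyx].
  by apply/conjg_fixP/commgP.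
by apply/commgP/conjg_fixP.
Qed.

Lemma sum_gbase_conj x :
  \sum_(y in G) gbase (x ^ y)%g = #|'C_G[x]%g|%:R *: gsum (x ^: G)%g.
Proof.
apply/ffunP=> t; apply: (etrans (galg_sumE _ _ _ _)).
apply: (etrans _ (esym (galg_scaleE _ _ _))); rewrite gsumE.
under eq_bigr => y _ do rewrite gbaseE.
have [/imsetP[y Gy ->] | xGt] := boolP (t \in _); last first.
  rewrite mulr0 big1 // => y Gy; case: eqP xGt => // ->.
  by rewrite memJ_class.
rewrite mulr1 -natr_sum -big_mkcondr /= sum1_card; congr _%:R.
rewrite -(card_rcoset _ y); apply: eq_card => z.
rewrite mem_rcoset inE [in LHS]unfold_in mem_cent1J groupMr ?groupV // conjgM.
by congr (_ && _); rewrite -[in RHS](inj_eq (conjg_inj y)) conjgKV eq_sym.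
Qed.

Lemma cavgE x : cavg G x = (#|G|%:R^-1 * #|'C_G[x]%g|%:R) *: gsum (x ^: G)%g.
Proof. by rewrite /cavg sum_gbase_conj scalerA. Qed.

Lemma galg_centerS u : u \in galg_center G -> u \in galg_of G.
Proof. by rewrite memv_cap => /andP[]. Qed.

Lemma galg_centerC u v :
  u \in galg_center G -> v \in galg_of G -> u * v = v * u.
Proof. by rewrite memv_cap => /andP[_ /centvP uC] /uC. Qed.

Lemma galg_centerM u v :
  u \in galg_center G -> v \in galg_center G -> u * v \in galg_center G.
Proof.
move=> uZ vZ; have [uG vG] := (galg_centerS uZ, galg_centerS vZ).
rewrite memv_cap galg_of_mul //=; apply/centvP=> w wG.
by rewrite -mulrA (galg_centerC vZ wG) mulrA (galg_centerC uZ wG) mulrA.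
Qed.

Lemma galg_conj_center u : u \in galg_center G -> galg_conj u \in galg_center G.
Proof.
case/galg_centerP=> /galg_ofP uG uJ; apply/galg_centerP; split=> [|x y Gy].
  by apply/galg_ofP=> x Gx; rewrite galg_conjE uG ?groupV // conjC0.
by rewrite !galg_conjE -conjVg uJ.
Qed.

Lemma gsum_class_center x : x \in G -> gsum (x ^: G)%g \in galg_center G.
Proof.
move=> Gx; apply/galg_centerP; split=> [|t y Gy]; last first.
  by rewrite !gsumE (class_transl _ (memJ_class t Gy)).
apply/galg_ofP=> t Gt; rewrite gsumE (_ : _ \in _ = false) //.
by apply: contraNF Gt; apply: (subsetP (class_subG Gx (subxx G))).
Qed.

Lemma cavg_center x : x \in G -> cavg G x \in galg_center G.
Proof. by move=> Gx; rewrite cavgE memvZ ?gsum_class_center. Qed.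

(** A central element equals its own average under conjugation by G. *)
Lemma cavg_frame v :
  v \in galg_center G -> v = \sum_(x in G) v x *: cavg G x.
Proof.
case/galg_centerP=> vG vJ; have nzG := neq0CG G.
under eq_bigr => x _ do rewrite /cavg scalerA mulrC -scalerA scaler_sumr.
rewrite -scaler_sumr exchange_big /=.
under eq_bigr => y Gy.
  rewrite (reindex_acts 'J _ (groupVr Gy)) ?astabsJ ?(subsetP (normG G))
    ?groupV //=.
  under eq_bigr => x Gx do rewrite vJ ?groupV // conjgKV.
  rewrite -(galg_of_sum vG); over.
by rewrite sumr_const -scaler_nat scalerA mulVf // scale1r.
Qed.

Lemma tr_centerE w :
  w \in galg_center G -> tr_center G w = \sum_(x in G) (w * cavg G x) x :> algC.
Proof.
move=> wZ; rewrite /tr_center.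
rewrite (@trace_on_frame _ _ _ _ _ [in G] (cavg G) (fun x v => v x : algC)).
- by apply: eq_bigr => x _; rewrite lfunE.
- by move=> x a u v; rewrite ffunE; congr (_ + _); apply: galg_scaleE.
- exact: cavg_frame.
by move=> x Gx; rewrite lfunE /= galg_centerM ?cavg_center.
Qed.

Lemma tr_centerZ a w : tr_center G (a *: w) = a * tr_center G w.
Proof.
rewrite /tr_center /trace_on -mxtraceZ; congr (\tr _).
by apply/matrixP=> i j; rewrite !mxE !lfunE /= -scalerAl linearZ.
Qed.

End Centre.

(** * The projection to the group algebra of a quotient *)

Section Push.
Variables (gT : finGroupType) (G N : {group gT}).
Hypothesis nsNG : (N <| G)%g.
Implicit Types (u v w : galg gT) (x y z : gT).

Let sGN : (G \subset 'N(N))%g := normal_norm nsNG.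

Lemma eq_coset x y : x \in G -> y \in G ->
  (coset N x == coset N y) = (x \in N :* y)%g.
Proof. by move=> Gx Gy; apply/eqP/rcoset_kercosetP; rewrite ?(subsetP sGN). Qed.

Lemma sum_quotient (V : nmodType) (F : coset_of N -> V) :
  \sum_(x in G) F (coset N x) = (\sum_(y in (G / N)%g) F y) *+ #|N|.
Proof.
rewrite (partition_big (coset N) [in (G / N)%g]) /= => [|x Gx]; last first.
  exact: mem_quotient.
rewrite -sumrMnl; apply: eq_bigr => _ /morphimP[y Ny Gy ->].
transitivity (\sum_(x in (N :* y)%g) F (coset N y));
  last by rewrite sumr_const card_rcoset.
apply: eq_big => [x | x /andP[_ /eqP->] //].
apply/andP/idP=> [[Gx]|Nyx]; first by rewrite eq_coset.
have Gx : x \in G.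
  by case/rcosetP: Nyx => n Nn ->;
    rewrite groupM // (subsetP (normal_sub nsNG)).
by rewrite eq_coset.
Qed.

(** Outside the normaliser of N, coset N is trivial, so that push is an algebra
   morphism only on subalgebras galg_of G with G normalising N. *)
Definition push u : galg (coset_of N) :=
  \sum_(x : gT) u x *: gbase (coset N x).

Fact push_is_linear : linear push.
Proof.
move=> a u v; rewrite /push scaler_sumr -big_split; apply: eq_bigr => x _ /=.
by rewrite scalerA -scalerDl; congr (_ *: _); rewrite ffunE; congr (_ + _);
  apply: galg_scaleE.
Qed.

HB.instance Definition _ :=
  GRing.isLinear.Build algC (galg gT) (galg (coset_of N)) _ push push_is_linear.

Lemma push_gbase x : push (gbase x) = gbase (coset N x).
Proof.
rewrite /push (bigD1 x) //= gbaseE eqxx scale1r big1 ?addr0 // => y /negPf yx.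
by rewrite gbaseE yx scale0r.
Qed.

Lemma push_of u : u \in galg_of G -> push u \in galg_of (G / N)%g.
Proof.
move/galg_of_sum->; rewrite linear_sum memv_suml // => x Gx.
by rewrite linearZ memvZ //= push_gbase gbase_galg_of ?mem_quotient.
Qed.

Lemma pushM u v : u \in galg_of G -> v \in galg_of G ->
  push (u * v) = push u * push v.
Proof.
move=> /galg_of_sum-> /galg_of_sum->.
rewrite !linear_sum /= !mulr_suml linear_sum; apply: eq_bigr => x Gx.
rewrite !mulr_sumr linear_sum; apply: eq_bigr => y Gy.
rewrite !linearZ /= !push_gbase -!scalerAl -!scalerAr !linearZ /= !gbaseM.
by rewrite push_gbase morphM ?(subsetP sGN) // !scalerA [v y * _]mulrC.
Qed.

Lemma push_conj u : u \in galg_of G -> push (galg_conj u) = galg_conj (push u).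
Proof.
move=> /galg_ofP uG; apply/ffunP=> t.
apply: (etrans _ (esym (galg_conjE _ _))).
rewrite /push !galg_sumE rmorph_sum (reindex_inj invg_inj) /=.
apply: eq_bigr => x _; rewrite !galg_scaleE !gbaseE galg_conjE invgK rmorphM /=
  conjC_nat.
have [Gx | Gx] := boolP (x \in G); last by rewrite uG // conjC0 !mul0r.
by rewrite morphV ?(subsetP sGN) // -(inj_eq invg_inj) invgK.
Qed.

Lemma push_cavg x : x \in G -> push (cavg G x) = cavg (G / N)%g (coset N x).
Proof.
move=> Gx; rewrite /cavg linearZ linear_sum /=.
under eq_bigr => y Gy do rewrite push_gbase morphJ ?(subsetP sGN) //.
rewrite (sum_quotient (fun t : coset_of N =>
  gbase (coset N x ^ t)%g)) -scaler_nat scalerA.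
congr (_ *: _); rewrite card_quotient // -divgS ?normal_sub //.
by rewrite natf_div ?cardSg ?normal_sub // invf_div mulrC.
Qed.

(** An element invariant under N is determined by its image: this is what allows
   a trace on Z(CG) to be read off in the quotient. *)
Lemma push_invariant u x : x \in G -> u \in galg_of G ->
  {in N, forall n, gbase n * u = u} ->
    push u (coset N x) = #|N|%:R * u x :> algC.
Proof.
move=> Gx /galg_ofP uG uN; rewrite galg_sumE.
transitivity (\sum_(y in (N :* x)%g) u x : algC); last first.
  by rewrite sumr_const card_rcoset mulr_natl.
rewrite [RHS]big_mkcond; apply: eq_bigr => y _; rewrite galg_scaleE gbaseE.
have [Gy | Gy] := boolP (y \in G); last first.
  rewrite uG // mul0r (_ : _ \in _ = false) //.
  apply: contraNF Gy => /rcosetP[n Nn ->]; rewrite groupM //.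
  exact: subsetP (normal_sub nsNG) _ Nn.
rewrite eq_sym eq_coset //.
case: rcosetP => [[n Nn ->]|_]; last by rewrite mulr0.
by rewrite mulr1 -[in LHS](uN n Nn) gbase_mull mulKg.
Qed.

Lemma push_center u : u \in galg_center G -> push u \in galg_center (G / N)%g.
Proof.
move=> uZ; rewrite memv_cap push_of ?galg_centerS //=.
apply/centvP=> v /galg_of_sum->; rewrite mulr_sumr mulr_suml.
apply: eq_bigr => _ /morphimP[x Nx Gx ->].
rewrite -scalerAl -scalerAr -push_gbase -!pushM ?gbase_galg_of ?galg_centerS //.
by rewrite (galg_centerC uZ) ?gbase_galg_of.
Qed.

(** In the formula tr(w) = sum_x (w c_x)(x), each summand depends on the coset of
   x alone, and the |N| elements of a coset cancel the factor |N|^-1 from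
   push_invariant. *)
Lemma tr_center_push w : w \in galg_center G ->
  {in N, forall n, gbase n * w = w} ->
    tr_center G w = tr_center (G / N)%g (push w).
Proof.
move=> wZ wN; rewrite !tr_centerE ?push_center //.
apply: (mulfI (neq0CG N)); rewrite mulr_sumr [RHS]mulr_natl.
rewrite -(sum_quotient (fun t => (push w * cavg (G / N)%g t) t : algC)).
apply: eq_bigr => x Gx; rewrite -push_cavg // -pushM ?galg_centerS ?cavg_center
  //.
rewrite push_invariant //;
  first by rewrite galg_of_mul ?galg_centerS ?cavg_center.
by move=> n Nn; rewrite mulrA wN.
Qed.

End Push.

(** * Gram determinants *)

Section Gram.
Variables (gT : finGroupType) (G : {group gT}).

Lemma galg_dotZ a b (u v : galg gT) :
  galg_dot G (a *: u) (b *: v) = a^* * b * galg_dot G u v.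
Proof.
rewrite /galg_dot -tr_centerZ; congr tr_center.
have ->: galg_conj (a *: u) = a^* *: galg_conj u.
  apply/ffunP=> x; apply: (etrans (galg_conjE _ _));
    rewrite galg_scaleE rmorphM /=.
  by rewrite -galg_conjE; apply/esym/galg_scaleE.
by rewrite -scalerAl -scalerAr scalerA.
Qed.

(** Indexing by n instead of size s lets permuted or mapped sequences share one
   matrix type. *)
Lemma gamma_tupleE n (t : n.-tuple (galg gT)) :
  gamma G t = `|\det (\matrix_(i < n, j < n) galg_dot G (tnth t i) (tnth t j))|.
Proof.
case: t => s eq_s; have Dn := eqP eq_s; subst n.
congr `|\det _|; apply/matrixP=> i j.
by rewrite !mxE !(tnth_nth 0).
Qed.

Lemma gamma_perm (B1 B2 : seq (galg gT)) : perm_eq B1 B2 ->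
  gamma G B1 = gamma G B2.
Proof.
move=> /(tuple_permP (t := in_tuple B2))[p ->].
rewrite (gamma_tupleE [tuple tnth (in_tuple B2) (p i) | i < size B2]).
rewrite (gamma_tupleE (in_tuple B2)) /=.
pose M := \matrix_(i < size B2, j < size B2)
  galg_dot G (tnth (in_tuple B2) i) (tnth (in_tuple B2) j).
rewrite -/M.
have ->: (\matrix_(i < size B2, j < size B2)
      galg_dot G (tnth [tuple tnth (in_tuple B2) (p i) | i < size B2] i)
        (tnth [tuple tnth (in_tuple B2) (p i) | i < size B2] j))
   = row_perm p (col_perm p M).
  by apply/matrixP=> i j; rewrite !mxE !tnth_mktuple.
rewrite row_permE col_permE !det_mulmx !det_perm.
by rewrite !normrM !normr_sign mulr1 mul1r.
Qed.

End Gram.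

(** The two Gram matrices are related by M' = D^* M D with D = diag(c). *)
Lemma gamma_transfer (gT rT : finGroupType) (G : {group gT}) (H : {group rT})
    (I : eqType) (s : seq I) (F : I -> galg gT) (E : I -> galg rT) (c : I ->
      algC) :
    {in s &, forall i j, galg_dot G (F i) (F j) =
      galg_dot H (c i *: E i) (c j *: E j)} ->
  gamma G (map F s) = (\prod_(i <- s) `|c i|) ^+ 2 * gamma H (map E s).
Proof.
move=> dotFE; rewrite (gamma_tupleE G [tuple of map F (in_tuple s)]).
rewrite (gamma_tupleE H [tuple of map E (in_tuple s)]).
set M := (\matrix_(i, j) galg_dot H _ _).
pose d := \row_(i < size s) c (tnth (in_tuple s) i).
have ->: \matrix_(i < size s, j < size s)
      galg_dot G (tnth [tuple of map F (in_tuple s)] i)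
        (tnth [tuple of map F (in_tuple s)] j)
   = diag_mx (map_mx Num.conj d) *m M *m diag_mx d.
  apply/matrixP=> i j; rewrite mul_mx_diag mul_diag_mx !mxE !tnth_map.
  by rewrite dotFE ?mem_tnth // galg_dotZ mulrAC.
rewrite !det_mulmx !det_diag !normrM !normr_prod mulrAC expr2 (big_tnth _ _ s).
by congr (_ * _ * _); apply: eq_bigr => i _; rewrite !mxE ?norm_conjC.
Qed.

(** * The index set of the basis *)

Section Index.
Variables (gT : finGroupType) (G Z : {group gT}) (g : {set coset_of Z} -> gT).
Implicit Types (N : {group gT}).

(** The disjoint union of the sets I(G:Z)_X for X contained in N. *)
Definition class_index (N : {set gT}) : {set {set coset_of Z}} :=
  [set j in classes (G / Z)%g | AnnZ Z (lifted_class G g j) \subset N].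

Lemma AnnZ_group_set (K : {set gT}) : group_set (AnnZ Z K).
Proof.
apply/group_setP; split=> [|x y]; first by rewrite inE group1 mul1g eqxx.
rewrite !inE => /andP[Zx /eqP xK] /andP[Zy /eqP yK].
by rewrite groupM // lcosetM yK xK eqxx.
Qed.
Canonical AnnZ_group K := Group (AnnZ_group_set K).

Lemma mem_IZ N j : (j \in IZ G g N) =
  (j \in classes (G / Z)%g) && (N == AnnZ_group (lifted_class G g j)).
Proof. by rewrite inE eq_sym. Qed.

Lemma perm_class_index N :
  perm_eq [seq j | X : {group gT} <- enum (subgroups N), j <- enum (IZ G g X)]
          (enum (class_index N)).
Proof.
apply: uniq_perm; rewrite ?enum_uniq //.
  apply: allpairs_uniq_dep => [|X _|]; rewrite ?enum_uniq //.
  move=> _ _ /allpairsPdep[X [j [_ Xj ->]]] /allpairsPdep[Y [k [_ Yk ->]]] /=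
    eq_jk.
  move: Xj Yk; rewrite -{k}eq_jk !mem_enum !mem_IZ => /andP[_ /eqP->].
  by case/andP=> _ /eqP->.
move=> j; apply/allpairsPdep/idP => [[X [k [sXN Xk ->]]] | ].
  by move: sXN Xk; rewrite !mem_enum !inE => sXN /andP[-> /eqP->].
rewrite mem_enum inE => /andP[Gj sAN].
by exists (AnnZ_group (lifted_class G g j)), j;
  rewrite !mem_enum mem_IZ Gj inE sAN eqxx.
Qed.

Lemma big_class_index (R : Type) (idx : R) (op : Monoid.com_law idx) N
    (F : {group gT} -> {set coset_of Z} -> R) :
  \big[op/idx]_(X in subgroups N) \big[op/idx]_(j in IZ G g X) F X j =
  \big[op/idx]_(j in class_index N) F (AnnZ_group (lifted_class G g j)) j.
Proof.
rewrite (exchange_big_dep [in class_index N]) /= => [|X j sXN]; last first.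
  by rewrite !inE in sXN * => /andP[-> /eqP->].
apply: eq_bigr => j; rewrite inE => /andP[Gj sAN].
rewrite (big_pred1 (AnnZ_group (lifted_class G g j))) // => X /=.
by rewrite mem_IZ Gj /= andb_idl // => /eqP->; rewrite inE.
Qed.

Lemma gamma_phiE (phi : 'CF(Z)) :
  gamma_phi G g phi =
  gamma G [seq e_ phi * gsum (lifted_class G g j) | j <- enum (class_index
    (cfker phi))].
Proof.
by rewrite -(gamma_perm _ (perm_map _ (perm_class_index _))) map_allpairs.
Qed.

Lemma c_phiE (phi : 'CF(Z)) : abelian Z ->
  c_phi G g phi = \prod_(j in class_index (cfker phi))
    (#|'C_G[g j]%g|%:R * (#|AnnZ Z (lifted_class G g j)|%:R / #|Z|%:R)).
Proof.
move=> abZ; rewrite /c_phi big_class_index; apply: eq_bigr => j _;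
  congr (_ * _).
set A := AnnZ_group _; have sAZ: A \subset Z by apply/subsetP=> x;
  rewrite inE => /andP[].
rewrite card_quotient ?(subset_trans abZ) ?cents_norm ?centS //.
by rewrite -divgS // natf_div ?cardSg // invf_div.
Qed.

Lemma kappaE N : kappa G g N =
  (\prod_(j in class_index N) #|AnnZ Z (lifted_class G g j)|)%N.
Proof.
rewrite -(big_class_index muln N (fun X _ => #|X|)); apply: eq_bigr => X _.
by rewrite prod_nat_const.
Qed.

End Index.

(** * Classes and a central subgroup *)

Section CentralSubgroup.
Variables (gT : finGroupType) (G Z : {group gT}).
Hypothesis sZG : Z \subset 'Z(G)%g.
Implicit Types (x y z : gT).

Let sZ : Z \subset G. Proof. exact: subset_trans sZG (center_sub G). Qed.

Lemma conj_central x y z : z \in Z -> y \in G -> ((z * x) ^ y = z * x ^ y)%g.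
Proof.
move=> Zz Gy; rewrite conjMg; congr (_ * _)%g.
apply/conjg_fixP/commgP.
by have /centerP[_] := subsetP sZG z Zz; apply.
Qed.

Lemma class_mul_central x z : z \in Z -> ((z * x) ^: G = z *: (x ^: G))%g.
Proof.
move=> Zz; apply/setP=> t;
  apply/imsetP/lcosetP => [[y Gy ->] | [_ /imsetP[y Gy ->] ->]].
  by exists (x ^ y)%g; rewrite ?memJ_class ?conj_central.
by exists y; rewrite ?conj_central.
Qed.

Lemma mem_AnnZ x z : (z \in AnnZ Z (x ^: G)%g) =
  (z \in Z) && (z * x \in x ^: G)%g.
Proof.
rewrite inE; apply: andb_id2l => Zz; rewrite -class_mul_central //.
by apply/eqP/class_eqP.
Qed.

Lemma AnnZ_mul_central x z : z \in Z ->
  AnnZ Z ((z * x) ^: G)%g = AnnZ Z (x ^: G)%g.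
Proof.
move=> Zz; apply/setP=> t; rewrite !mem_AnnZ; apply: andb_id2l => Zt.
have ->: (t * (z * x) = z * (t * x))%g.
  rewrite !mulgA; congr (_ * _)%g.
  have /centerP[_ cG] := subsetP sZG t Zt; exact: cG (subsetP sZ z Zz).
by rewrite class_mul_central // mem_lcoset mulKg.
Qed.

Lemma card_cent_mul_central x z : z \in Z -> #|'C_G[z * x]%g| = #|'C_G[x]%g|.
Proof.
move=> Zz; apply: eq_card => y; rewrite !inE; apply: andb_id2l => Gy.
have := mem_cent1J (z * x)%g y; rewrite conj_central // (inj_eq (mulgI z)).
by rewrite -mem_cent1J !inE.
Qed.

Lemma gsum_mul_central x z : z \in Z ->
  gsum ((z * x) ^: G)%g = gbase z * gsum (x ^: G)%g.
Proof.
move=> Zz; apply/ffunP=> t; rewrite class_mul_central //.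
apply: (etrans (gsumE _ _)); apply: (etrans _ (esym (gbase_mull _ _ _))).
by rewrite gsumE mem_lcoset.
Qed.

Section Phi.
Variable phi : 'CF(Z).
Hypothesis lin_phi : phi \is a linear_char.

Lemma e_E x : e_ phi x = #|Z|%:R^-1 * (phi x)^* :> algC.
Proof.
apply: (etrans (galg_scaleE _ _ _)); congr (_ * _); rewrite galg_sumE.
under eq_bigr => z _ do rewrite galg_scaleE gbaseE.
have [Zx | Zx] := boolP (x \in Z); last first.
  rewrite cfun0 // conjC0 big1 // => z Zz; case: eqP Zx => [->|_ _].
    by rewrite Zz.
  by rewrite mulr0.
rewrite (bigD1 x) //= eqxx mulr1 big1 ?addr0 // => z /andP[_ /negPf].
by rewrite eq_sym => ->; rewrite mulr0.
Qed.

Lemma gbase_e_ z : z \in Z -> gbase z * e_ phi = phi z *: e_ phi.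
Proof.
move=> Zz; apply/ffunP=> x; apply: (etrans (gbase_mull _ _ _)).
apply: (etrans _ (esym (galg_scaleE _ _ _))); rewrite !e_E mulrCA;
  congr (_ * _).
have [Zx | Zx] := boolP (x \in Z); last first.
  have Zzx: (z^-1 * x)%g \notin Z by rewrite groupMl ?groupV.
  by rewrite (cfun0 phi Zx) (cfun0 phi Zzx) conjC0 mulr0.
by rewrite lin_charM ?groupV // lin_charV_conj // rmorphM /= conjCK.
Qed.

Lemma e_center : e_ phi \in galg_center G.
Proof.
have nsZG : (Z <| G)%g by rewrite sub_center_normal.
apply/galg_centerP; split.
  apply/galg_ofP=> x Gx; rewrite e_E cfun0 ?conjC0 ?mulr0 //.
  by apply: contra Gx; apply: subsetP.
move=> x y Gy; rewrite !e_E; congr (_ * _^*).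
have [Zx | Zx] := boolP (x \in Z); last first.
  by rewrite !cfun0 // memJ_norm // (subsetP (normal_norm nsZG)).
by rewrite -[x]mulg1 conj_central // conj1g.
Qed.

(** Changing the representative of a Z-orbit of classes changes the corresponding
   basis element by a value of phi, which has modulus one. *)
Lemma e_gsum_mul_central x z : z \in Z ->
  e_ phi * gsum ((z * x) ^: G)%g = phi z *: (e_ phi * gsum (x ^: G)%g).
Proof.
move=> Zz; rewrite gsum_mul_central // mulrA (galg_centerC e_center).
  by rewrite gbase_e_ // scalerAl.
by rewrite gbase_galg_of ?(subsetP sZ).
Qed.

End Phi.

Section ClassImage.
Variable N : {group gT}.
Hypothesis sNZ : N \subset Z.

Let nsNG : (N <| G)%g.
Proof. by rewrite sub_center_normal // (subset_trans sNZ). Qed.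

(** Images of class averages are class averages, so the image of the class sum
   is some multiple of [K_xb].  The multiple is the coefficient at xb, the
   number of n in N such that n x is conjugate to x. *)
Lemma push_gsum_class x : x \in G ->
  push N (gsum (x ^: G)%g) =
    #|AnnZ N (x ^: G)%g|%:R *: gsum (coset N x ^: (G / N))%g.
Proof.
move=> Gx; pose b := (#|G|%:R^-1 * #|'C_G[x]%g|%:R : algC).
have nzb : b != 0 by rewrite mulf_neq0 ?invr_eq0 ?neq0CG.
have := push_cavg nsNG Gx; rewrite !cavgE linearZ /= -/b.
move=> /(congr1 ( *:%R b^-1)); rewrite !scalerA mulVf // scale1r.
set a := _ * _ => Dp; rewrite Dp; congr (_ *: _).
have := congr1 (fun u : galg _ => u (coset N x) : algC) Dp.
rewrite /= galg_scaleE gsumE class_refl mulr1 => <-.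
rewrite /push galg_sumE; under eq_bigr =>
  y _ do rewrite galg_scaleE gbaseE gsumE.
transitivity (\sum_(y | (y \in x ^: G)%g && (y \in N :* x)%g) (1 : algC)).
  rewrite [RHS]big_mkcond; apply: eq_bigr => y _.
  have [xGy | _] := boolP (y \in (x ^: G)%g); last by rewrite mul0r.
  have Gy : y \in G by apply: subsetP xGy; apply: class_subG.
  by rewrite mul1r eq_sym (eq_coset nsNG) //=; case: ifP.
rewrite sumr_const -(card_rcoset (AnnZ N (x ^: G)%g) x); congr _%:R.
apply: eq_card => y; rewrite mem_rcoset inE [LHS]unfold_in.
rewrite andbC mem_rcoset; apply: andb_id2l => Nyx.
rewrite -class_mul_central ?(subsetP sNZ) // mulgKV.
by apply/class_eqP/eqP.
Qed.

End ClassImage.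
End CentralSubgroup.

(** * Passing to the quotient by a central subgroup *)

Lemma card_cent1J (gT : finGroupType) (G : {group gT}) x y :
  y \in G -> #|'C_G[x ^ y]%g| = #|'C_G[x]%g|.
Proof. by move=> Gy; rewrite cent1J -{1}(conjGid Gy) -conjIg cardJg. Qed.

Lemma class_quotientP (gT : finGroupType) (G N : {group gT}) x t :
    (N <| G)%g -> x \in G -> t \in G ->
  reflect (exists2 n, n \in N & exists2 y, y \in G & x = n * t ^ y)%g
          (coset N x \in coset N t ^: (G / N))%g.
Proof.
move=> nsNG Gx Gt; have sGN := subsetP (normal_norm nsNG).
apply: (iffP imsetP) => [[_ /morphimP[y Ny Gy ->]] | [n Nn [y Gy ->]]].
  rewrite -morphJ ?sGN // => /eqP; rewrite (eq_coset nsNG) ?groupJ //.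
  by case/rcosetP=> n Nn ->; exists n => //; exists y.
exists (coset N y); rewrite ?mem_quotient // -morphJ ?sGN //.
apply/eqP; rewrite (eq_coset nsNG) ?mem_rcoset ?mulgK ?groupJ // groupM ?groupJ
  //.
exact: subsetP (normal_sub nsNG) _ Nn.
Qed.

Section CentralQuotient.
Variables (gT : finGroupType) (G Z N : {group gT}).
Hypotheses (sZG : Z \subset 'Z(G)%g) (sNZ : N \subset Z).
Implicit Types (x y z : gT).

Let nsNG : (N <| G)%g.
Proof. by rewrite sub_center_normal // (subset_trans sNZ). Qed.

Let sZ : Z \subset G. Proof. exact: subset_trans sZG (center_sub G). Qed.

Let sGN := subsetP (normal_norm nsNG).

Lemma quotient_central : (Z / N \subset 'Z(G / N))%g.
Proof.
move: sZG; rewrite !subsetI => /andP[sZG' cZG].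
by rewrite quotientS ?quotient_cents.
Qed.

(** Compares the coefficients at xb in push_cavg and push_gsum_class. *)
Lemma card_cent_quotient x : x \in G ->
  #|'C_G[x]%g|%:R * #|AnnZ N (x ^: G)%g|%:R
    = #|N|%:R * #|'C_(G / N)[coset N x]%g|%:R :> algC.
Proof.
move=> Gx; have := push_cavg nsNG Gx.
rewrite !cavgE linearZ /= (push_gsum_class sZG sNZ Gx) scalerA.
move=> /(congr1 (fun u : galg _ => u (coset N x) : algC)).
rewrite !galg_scaleE gsumE class_refl !mulr1 => /(congr1 ( *%R #|G|%:R)).
rewrite -mulrA mulVKf ?neq0CG // => ->; rewrite mulrA; congr (_ * _).
rewrite card_quotient ?normal_norm // -divgS ?normal_sub //.
by rewrite natf_div ?cardSg ?normal_sub // invf_div mulrC divfK ?neq0CG.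
Qed.

(** zb fixes K_xb exactly when n z fixes K_x for some n in N: the annihilator of
   K_xb is the image of that of K_x. *)
Lemma AnnZ_quotient_trivial x : x \in G ->
  (AnnZ (Z / N) (coset N x ^: (G / N)) \subset [1])%g
    = (AnnZ Z (x ^: G)%g \subset N).
Proof.
move=> Gx; apply/subsetP/subsetP => [trA z | sAN t].
  rewrite (mem_AnnZ sZG) => /andP[Zz xGzx]; have Gz := subsetP sZ z Zz.
  apply: coset_idr; rewrite ?sGN //; apply/set1P/trA.
  rewrite (mem_AnnZ quotient_central) mem_quotient // -morphM ?sGN //.
  by case/imsetP: xGzx => y Gy ->;
    rewrite morphJ ?sGN // memJ_class ?mem_quotient.
rewrite (mem_AnnZ quotient_central) => /andP[/morphimP[z Nz Zz ->]].
have Gz := subsetP sZ z Zz; rewrite -morphM ?sGN //.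
case/(class_quotientP nsNG (groupM Gz Gx) Gx)=> n Nn [y Gy Dzx].
have Zn := subsetP sNZ n Nn;
  suffices Nz' : z \in N by rewrite /= coset_id ?set11.
rewrite -(groupMl _ (groupVr Nn)) sAN // (mem_AnnZ sZG) groupM ?groupV //=.
by rewrite -mulgA Dzx mulKg memJ_class.
Qed.

Lemma AnnZ_sub x : AnnZ Z (x ^: G)%g \subset N ->
  AnnZ N (x ^: G)%g = AnnZ Z (x ^: G)%g.
Proof.
move=> sAN; apply/setP=> z; rewrite !inE; apply/andP/andP=> -[Hz zK];
  split=> //.
  exact: subsetP sNZ z Hz.
by apply: (subsetP sAN); rewrite inE Hz.
Qed.

(** This replaces the isomorphism of (G / N) / (Z / N) with G / Z: conjugacy in
   the double quotient is conjugacy in G up to Z, the element of N that remains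
   being invisible in G / N. *)
Lemma class_quotient2P x t : x \in G -> t \in G ->
  reflect (exists2 z, z \in Z & exists2 y, y \in G & coset N x =
    coset N (z * t ^ y))%g
    (coset (Z / N) (coset N x) \in coset (Z / N) (coset N t) ^: ((G / N) / (Z /
      N)))%g.
Proof.
move=> Gx Gt; have nsZNGN : (Z / N <| G / N)%g by rewrite sub_center_normal
  ?quotient_central.
apply: (iffP (class_quotientP nsZNGN (mem_quotient N Gx) (mem_quotient N Gt))).
  case=> _ /morphimP[z Nz Zz ->] [_ /morphimP[y Ny Gy ->] Dx]; exists z => //.
  by exists y => //; rewrite Dx -morphJ -?morphM ?sGN ?groupJ // (subsetP sZ).
case=> z Zz [y Gy Dx]; exists (coset N z); rewrite ?mem_quotient //.
exists (coset N y); rewrite ?mem_quotient // Dx morphM ?morphJ ?sGN ?groupJ //.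
exact: (subsetP sZ).
Qed.

Lemma galg_dot_push u v : u \in galg_center G -> v \in galg_center G ->
    {in N, forall n, gbase n * v = v} ->
  galg_dot G u v = galg_dot (G / N)%g (push N u) (push N v).
Proof.
move=> uZ vZ vN; have cuZ := galg_conj_center uZ; rewrite /galg_dot.
rewrite (tr_center_push nsNG) ?galg_centerM // => [|n Nn].
  by rewrite (pushM nsNG) ?(push_conj nsNG) // galg_centerS.
by rewrite (galg_centerC cuZ) ?(galg_centerS vZ) // mulrA vN.
Qed.

Variable phi : 'CF(Z).
Hypotheses (lin_phi : phi \is a linear_char) (sNphi : N \subset cfker phi).

Lemma push_e : push N (e_ phi) = e_ (phi / N)%CF.
Proof.
have nsNZ : (N <| Z)%g := normalS sNZ sZ nsNG.
rewrite /e_ linearZ linear_sum /=.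
under eq_bigr => z Zz do rewrite linearZ /= push_gbase -(cfQuoE nsNZ sNphi Zz).
rewrite (sum_quotient nsNZ (fun t =>
  ((phi / N)%CF t)^* *: gbase t)) -scaler_nat scalerA.
congr (_ *: _); rewrite card_quotient ?normal_norm // -divgS //.
by rewrite natf_div ?cardSg // invf_div mulrC.
Qed.

Lemma push_e_gsum x : x \in G -> AnnZ Z (x ^: G)%g \subset N ->
  push N (e_ phi * gsum (x ^: G)%g) =
    #|AnnZ Z (x ^: G)%g|%:R *: (e_ (phi / N)%CF * gsum (coset N x ^: (G /
      N))%g).
Proof.
move=> Gx sAN; rewrite (pushM nsNG) ?galg_centerS ?(e_center sZG)
  ?gsum_class_center //.
by rewrite push_e (push_gsum_class sZG sNZ Gx) AnnZ_sub // scalerAr.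
Qed.

(** e_phi absorbs N because phi is trivial on N. *)
Lemma galg_dot_e_gsum x t : x \in G -> t \in G ->
  galg_dot G (e_ phi * gsum (x ^: G)%g) (e_ phi * gsum (t ^: G)%g) =
  galg_dot (G / N)%g (push N (e_ phi * gsum (x ^: G)%g)) (push N (e_ phi * gsum
    (t ^: G)%g)).
Proof.
move=> Gx Gt; have eZ := e_center sZG phi.
apply: galg_dot_push; rewrite ?galg_centerM ?gsum_class_center // => n Nn.
rewrite mulrA (gbase_e_ lin_phi) ?(subsetP sNZ) //.
by rewrite (cfker1 (subsetP sNphi n Nn)) lin_char1 // scale1r.
Qed.

End CentralQuotient.

(** * Matching the bases of G and of its quotient *)

Section ClassIndex.
Variables (gT : finGroupType) (G Z N : {group gT}).
Variables (g : {set coset_of Z} -> gT)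
          (h : {set coset_of (Z / N)} -> coset_of N).
Hypotheses (sZG : Z \subset 'Z(G)%g) (sNZ : N \subset Z).
Hypotheses (gP : class_choice G g) (hP : class_choice (G / N)%G h).

Let nsZG : (Z <| G)%g. Proof. exact: sub_center_normal. Qed.

Let nsNG : (N <| G)%g.
Proof. by rewrite sub_center_normal // (subset_trans sNZ). Qed.

(** The bijection from the classes of G / Z to those of (G / N) / (Z / N) given by
   the third isomorphism theorem, computed on the chosen representatives. *)
Definition quotient_class (j : {set coset_of Z}) : {set coset_of (Z / N)} :=
  (coset (Z / N) (coset N (g j)) ^: ((G / N) / (Z / N)))%g.

Lemma class_choice_classE (gT' : finGroupType) (G' Z' : {group gT'})
    (g' : {set coset_of Z'} -> gT') j :
  class_choice G' g' -> j \in classes (G' / Z')%g ->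
  j = (coset Z' (g' j) ^: (G' / Z'))%g.
Proof.
move=> g'P G'j; have [_] := g'P j G'j; case/imsetP: G'j => x _ ->.
by move/class_eqP.
Qed.

Lemma quotient_class_mem j : j \in classes (G / Z)%g ->
  quotient_class j \in classes ((G / N) / (Z / N))%g.
Proof. by case/gP=> Gg _; rewrite mem_classes ?mem_quotient. Qed.

Lemma quotient_class_inj : {in classes (G / Z)%g &, injective quotient_class}.
Proof.
move=> i j Gi Gj /class_eqP.
have [[Ggi _] [Ggj _]] := (gP Gi, gP Gj).
case/(class_quotient2P sZG sNZ Ggi Ggj) => z Zz [y Gy /eqP].
have Gz : z \in G by apply: subsetP (normal_sub nsZG) z Zz.
have Gt : (z * g j ^ y)%g \in G by rewrite groupM ?groupJ.
rewrite (eq_coset nsNG) // => /rcosetP[n Nn Dgi].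
rewrite (class_choice_classE gP Gi) (class_choice_classE gP Gj).
apply/class_eqP/(class_quotientP nsZG Ggi Ggj).
exists (n * z)%g; first by rewrite groupM // (subsetP sNZ).
by exists y; rewrite // Dgi mulgA.
Qed.

Lemma quotient_class_onto k : k \in classes ((G / N) / (Z / N))%g ->
  exists2 j, j \in classes (G / Z)%g & quotient_class j = k.
Proof.
move=> Gk; have [/morphimP[x Nx Gx /= Dhk] _] := hP Gk.
have Gj : (coset Z x ^: (G / Z))%g \in classes (G / Z)%g.
  by rewrite mem_classes ?mem_quotient.
exists (coset Z x ^: (G / Z))%g => //; have [Gg gx] := gP Gj.
rewrite (class_choice_classE hP Gk) Dhk; apply/class_eqP.
apply/(class_quotient2P sZG sNZ Gg Gx).
have [z Zz [y Gy ->]] := class_quotientP nsZG Gg Gx gx.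
by exists z => //; exists y.
Qed.

Lemma quotient_choiceE j : j \in classes (G / Z)%g ->
  exists z, z \in Z /\
    exists2 y, y \in G & h (quotient_class j) = coset N (z * g j ^ y)%g.
Proof.
move=> Gj; have Gk := quotient_class_mem Gj.
have [/morphimP[x Nx Gx /= Dhk] hk] := hP Gk; have [Gg _] := gP Gj.
rewrite Dhk in hk *.
by have [z Zz [y Gy ->]] := class_quotient2P sZG sNZ Gx Gg hk; exists z; split;
  [| exists y].
Qed.

(** The annihilator of a class is unchanged when its representative is multiplied
   by a central element, so the choice of h does not matter. *)
Lemma AnnZ_quotient_class j : j \in classes (G / Z)%g ->
  (AnnZ (Z / N)%g (lifted_class (G / N)%g h (quotient_class j)) \subset [1]%g)
    = (AnnZ Z (lifted_class G g j) \subset N).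
Proof.
move=> Gj; have [z [Zz [y Gy Dh]]] := quotient_choiceE Gj; have [Gg _] := gP Gj.
rewrite /lifted_class Dh (AnnZ_quotient_trivial sZG sNZ).
  by rewrite (AnnZ_mul_central sZG) // classGidl.
by rewrite groupM ?groupJ // (subsetP (normal_sub nsZG)).
Qed.

Lemma perm_quotient_class :
  perm_eq [seq quotient_class j | j <- enum (class_index G g N)]
          (enum (class_index (G / N)%G h 1%g)).
Proof.
have inA j : j \in class_index G g N -> j \in classes (G / Z)%g.
  by rewrite inE => /andP[].
apply: uniq_perm; rewrite ?enum_uniq ?map_inj_in_uniq ?enum_uniq //.
  by move=> i j; rewrite !mem_enum => /inA Gi /inA Gj;
    apply: quotient_class_inj.
move=> k; rewrite mem_enum; apply/mapP/idP=> [[j] | ].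
  rewrite mem_enum inE => /andP[Gj sAN] ->.
  by rewrite inE quotient_class_mem // AnnZ_quotient_class.
rewrite inE => /andP[/quotient_class_onto[j Gj <-]].
by rewrite AnnZ_quotient_class // => sAN; exists j; rewrite // mem_enum inE Gj.
Qed.

(** With A = Ann_Z(K_j) contained in N, both sides equal |N| |C_Gb(xb)| / |Z| by
   card_cent_quotient, the annihilator in the quotient being trivial. *)
Lemma c_term_quotient j : j \in class_index G g N ->
  #|'C_G[g j]%g|%:R * (#|AnnZ Z (lifted_class G g j)|%:R / #|Z|%:R) =
  #|'C_(G / N)[h (quotient_class j)]%g|%:R *
    (#|AnnZ (Z / N)%g (lifted_class (G / N)%g h (quotient_class j))|%:R
       / #|(Z / N)%g|%:R) :> algC.
Proof.
rewrite inE => /andP[Gj sAN]; have := sAN; rewrite -AnnZ_quotient_class //.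
have [z [Zz [y Gy Dh]]] := quotient_choiceE Gj; have [Gg _] := gP Gj.
rewrite -[AnnZ _ _]/(AnnZ_group _ _ : {set _}) => /trivgP->;
  rewrite cards1 mul1r.
have Gx : (z * g j ^ y)%g \in G.
  by rewrite groupM ?groupJ // (subsetP (normal_sub nsZG)).
have := card_cent_quotient sZG sNZ Gx.
rewrite Dh (card_cent_mul_central sZG) // card_cent1J //.
have eqA : AnnZ Z ((z * g j ^ y) ^: G)%g = AnnZ Z (lifted_class G g j).
  by rewrite (AnnZ_mul_central sZG) // classGidl.
rewrite (AnnZ_sub sNZ) ?eqA // => e; rewrite mulrA e mulrC.
have nNZ : Z \subset 'N(N)%g.
  exact: subset_trans (normal_sub nsZG) (normal_norm nsNG).
rewrite card_quotient // -divgS // natf_div ?cardSg // invf_div.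
by rewrite mulrC mulrAC mulrC.
Qed.

Variable phi : 'CF(Z).
Hypotheses (lin_phi : phi \is a linear_char) (sNphi : N \subset cfker phi).

(** The scalar a is |Ann_Z(K_j)| phi(z)^-1, where z is the central element by
   which the representative chosen by h differs from the image of g j. *)
Lemma e_gsum_quotient_class j : j \in class_index G g N ->
  exists a : algC, `|a| = #|AnnZ Z (lifted_class G g j)|%:R /\
    push N (e_ phi * gsum (lifted_class G g j)) =
    a *: (e_ (phi / N)%CF * gsum (lifted_class (G / N)%g h (quotient_class j))).
Proof.
rewrite inE => /andP[Gj sAN]; have [z [Zz [y Gy Dh]]] := quotient_choiceE Gj.
have [Gg _] := gP Gj; have nsNZ : (N <| Z)%g := normalS sNZ (normal_sub nsZG)
  nsNG.
have lin_phiN : (phi / N)%CF \is a linear_char by rewrite cfQuo_lin_char.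
have Gz : z \in G by apply: subsetP (normal_sub nsZG) z Zz.
have sGN := subsetP (normal_norm nsNG).
exists (#|AnnZ Z (lifted_class G g j)|%:R * (phi z)^-1); split.
  by rewrite normrM normfV normC_lin_char // invr1 mulr1 normr_nat.
rewrite (push_e_gsum sZG sNZ sNphi Gg sAN) /lifted_class Dh morphM ?sGN ?groupJ
  //.
rewrite (e_gsum_mul_central (quotient_central _ sZG)) ?mem_quotient //.
rewrite morphJ ?sGN // classGidl ?mem_quotient // scalerA cfQuoE //.
by rewrite divfK ?lin_char_neq0.
Qed.

End ClassIndex.

Theorem proposition3p6 (gT : finGroupType) (G Z : {group gT})
    (phi : 'CF(Z))
    (g : {set coset_of Z} -> gT)
    (h : {set coset_of (Z / cfker phi)} -> coset_of (cfker phi)) :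
  Z \subset 'Z(G)%g ->
  phi \in irr Z ->
  class_choice G g ->
  class_choice (G / cfker phi) h ->
  mu G g phi =
    (kappa G g (cfker phi))%:R ^+ 2 *
    mu (G / cfker phi) h (phi / cfker phi)%CF.
Proof.
move=> sZG irr_phi gP hP.
have abZ : abelian Z.
  exact: abelianS sZG (center_abelian G).
have lin_phi : phi \is a linear_char.
  by have /irrP[i ->] := irr_phi; apply/char_abelianP.
pose N : {group gT} := cfker_group phi.
have sNZ : N \subset Z := cfker_sub phi.
pose s := quotient_class G N g : {set coset_of Z} -> {set coset_of (Z / N)}.
pose A := class_index G g N; pose B := class_index (G / N)%G h 1%g.
have permAB : perm_eq (map s (enum A)) (enum B) := perm_quotient_class sZG sNZ
  gP hP.
have kerN : cfker (phi / N)%CF = 1%g.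
  by rewrite cfker_quo ?cfker_normal // trivg_quotient.
have eq_c : c_phi G g phi = c_phi (G / N) h (phi / N)%CF.
  rewrite !c_phiE ?quotient_abelian // kerN -/A -/B.
  rewrite -[LHS]big_enum -[RHS]big_enum -(perm_big _ permAB) big_map /=.
  rewrite big_seq [RHS]big_seq; apply: eq_bigr => j; rewrite mem_enum.
  exact: (c_term_quotient sZG sNZ gP hP).
rewrite /mu eq_c mulrA; congr (_ / _).
rewrite !gamma_phiE kerN -/A -/B -(gamma_perm _ (perm_map _ permAB)) -map_comp.
have /fin_all_exists[a aP] j : exists a : algC, j \in A ->
    `|a| = #|AnnZ Z (lifted_class G g j)|%:R /\
    push N (e_ phi * gsum (lifted_class G g j)) =
    a *: (e_ (phi / N)%CF * gsum (lifted_class (G / N)%g h (s j))).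
  have [Aj | _] := boolP (j \in A); last by exists 0.
  have [a aP] := e_gsum_quotient_class sZG sNZ gP hP lin_phi (subxx _) Aj.
  by exists a.
rewrite (gamma_transfer (H := (G / N)%G) (c := a)
  (E := fun j => e_ (phi / N)%CF * gsum (lifted_class (G / N)%g h (s j)))).
  congr (_ ^+ 2 * _); rewrite kappaE natr_prod -[RHS]big_enum /=.
  rewrite big_seq [RHS]big_seq; apply: eq_bigr => j; rewrite mem_enum.
  by case/aP.
move=> i j; rewrite !mem_enum => Ai Aj.
have [[_ <-] [_ <-]] := (aP i Ai, aP j Aj).
have GA k : k \in A -> g k \in G by rewrite inE => /andP[/gP[]].
by apply: galg_dot_e_gsum => //; apply: GA.
Qed.
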